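(* Let $\rho>0$ and suppose that $\mathrm{Null}(\mathbb{E}_{\mathcal D}[SHS^\top])\subseteq\mathrm{Null}(A^\top)$ and $\mathbb{E}_{\mathcal D}[W]\succ0$, and that there exists $\mu_{\mathcal D}>0$ such that $$\|x-x^*\|^2_{\mathbb{E}_{\mathcal D}[Z]}+\frac1\rho\|z\|^2_{\mathbb{E}_{\mathcal D}[W]}\ \ge\ \mu_{\mathcal D}\Big(\|x-x^*\|_B^2+\frac1\rho\|z\|_G^2\Big)\qquad\text{for all }x\in\mathbb{R}^n,\ z\in\mathbb{R}^p.$$ Then the penalty stochastic reformulation $$\min_{x\in\mathbb{R}^n} f(x,0,\rho)=\tfrac12\|x-x^*\|^2_{\mathbb{E}_{\mathcal D}[Z]}$$ and the augmented stochastic reformulation $$\min_{x\in\mathbb{R}^n,\,z\in\mathbb{R}^p} f(x,z,\rho)=\tfrac12\|x-x^*\|^2_{\mathbb{E}_{\mathcal D}[Z]}+\tfrac1{2\rho}\|z\|^2_{\mathbb{E}_{\mathcal D}[W]}$$ are equivalent to the linear system problem $\min\{\|x-x_0\|_B^2: x\in\mathbb{R}^n,\ Ax=b\}$. That is: $x$ minimizes $f(\cdot,0,\rho)$ if and only if $x$ solves this problem, i.e. $x=x^*$; and $(x,z)$ minimizes $f(\cdot,\cdot,\rho)$ if and only if $x=x^*$ and $z=0$.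
   Context: Let $A\in\mathbb{R}^{m\times n}$ and $b\in\mathbb{R}^m$ be such that $Ax=b$ is consistent, $x_0\in\mathbb{R}^n$ given, and $B\in\mathbb{R}^{n\times n}$, $G\in\mathbb{R}^{p\times p}$ symmetric positive definite. For a symmetric positive semidefinite $M$ write $\|x\|_M^2=x^\top Mx$. $\mathcal D$ is a probability distribution on real $m\times p$ matrices and $\mathbb{E}_{\mathcal D}$ is expectation over $S\sim\mathcal D$ (assumed to exist where used). For $S\sim\mathcal D$ define $$H=\Big(\tfrac1\rho G+S^\top AB^{-1}A^\top S\Big)^{-1},\quad Z=A^\top SHS^\top A,\quad F=\Big(\tfrac1\rho B+A^\top SG^{-1}S^\top A\Big)^{-1},\quad W=S^\top AFA^\top S.$$ $x^*=\arg\min\{\|x-x_0\|_B^2: Ax=b\}=x_0-B^{-1}A^\top(AB^{-1}A^\top)^\dagger(Ax_0-b)$. *)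

(* Defs.v *)
From HB Require Import structures.
From mathcomp Require Import all_boot all_order all_algebra.
From mathcomp Require Import all_classical all_reals all_analysis.

Set Implicit Arguments.
Unset Strict Implicit.
Unset Printing Implicit Defensive.
Import Order.TTheory GRing.Theory Num.Theory.
Import numFieldNormedType.Exports.

Local Open Scope classical_set_scope.
Local Open Scope ring_scope.

Definition sqnorm (R : realType) (n : nat) (M : 'M[R]_n) (x : 'cV[R]_n) : R :=
  (x^T *m M *m x) 0 0.

Definition posdef (R : realType) (n : nat) (M : 'M[R]_n) : Prop :=
  M^T = M /\ forall x : 'cV[R]_n, x != 0 -> 0 < sqnorm M x.

Definition nullspace (R : realType) (m n : nat) (M : 'M[R]_(m, n)) :
    set 'cV[R]_n :=
  [set x | M *m x = 0].

Definition minimizers (R : realType) (T : Type) (C : set T) (f : T -> R) :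
    set T :=
  [set x | C x /\ forall y, C y -> f x <= f y].

(* The four Penrose equations.  MathComp's [pinvmx] need not satisfy the last
   two, so it is not the Moore-Penrose inverse. *)
Definition penrose (R : realType) (m n : nat) (M : 'M[R]_(m, n))
    (P : 'M[R]_(n, m)) : Prop :=
  [/\ M *m P *m M = M, P *m M *m P = P,
      (M *m P)^T = M *m P & (P *m M)^T = P *m M].

Lemma gram_unitmx (R : realType) (r n : nat) (M : 'M[R]_(r, n)) :
  row_free M -> M *m M^T \in unitmx.
Proof.
move=> Mfree; rewrite -row_free_unit; apply/inj_row_free => v vMM0.
have ww0 : (v *m M) *m (v *m M)^T = 0.
  by rewrite trmx_mul mulmxA -(mulmxA v) vMM0 mul0mx.
apply: (row_free_inj Mfree); rewrite mul0mx.
move: (v *m M) ww0 => w /matrixP /(_ 0 0); rewrite !mxE => /eqP.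
rewrite psumr_eq0 => [/allP ww0|i _]; last by rewrite mxE -expr2 sqr_ge0.
apply/rowP => i; apply/eqP; rewrite mxE.
by have := ww0 i (mem_index_enum i); rewrite /= mxE -expr2 sqrf_eq0.
Qed.

Lemma penrose_exists (R : realType) (m n : nat) (M : 'M[R]_(m, n)) :
  exists P, penrose M P.
Proof.
have : row_free (row_base M) by exact: row_base_free.
have : row_full (col_base M) by exact: col_base_full.
move: (\rank M) (col_base M) (row_base M) (mulmx_base M).
move=> r C U defM Cfull Ufree.
have uU : U *m U^T \in unitmx by exact: gram_unitmx.
have uC : C^T *m C \in unitmx.
  have := @gram_unitmx R _ _ C^T; rewrite trmxK; apply.
  by rewrite /row_free mxrank_tr.
set Ui := U^T *m invmx (U *m U^T); set Ci := invmx (C^T *m C) *m C^T.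
have UK : U *m Ui = 1%:M by rewrite /Ui mulmxA mulmxV.
have CK : Ci *m C = 1%:M by rewrite /Ci -mulmxA mulVmx.
have symC : (C *m Ci)^T = C *m Ci.
  by rewrite /Ci !trmx_mul trmxK trmx_inv trmx_mul trmxK mulmxA.
have symU : (Ui *m U)^T = Ui *m U.
  by rewrite /Ui !trmx_mul trmxK trmx_inv trmx_mul trmxK mulmxA.
have MP : M *m (Ui *m Ci) = C *m Ci.
  by rewrite -defM mulmxA -(mulmxA C) UK mulmx1.
have PM : Ui *m Ci *m M = Ui *m U.
  by rewrite -defM mulmxA -(mulmxA Ui) CK mulmx1.
exists (Ui *m Ci); split; rewrite ?MP ?PM //.
- by rewrite -{1}defM mulmxA -(mulmxA C) CK mulmx1.
- by rewrite mulmxA -(mulmxA Ui) UK mulmx1.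
Qed.

Lemma penrose_unique (R : realType) (m n : nat) (M : 'M[R]_(m, n))
    (P Q : 'M[R]_(n, m)) : penrose M P -> penrose M Q -> P = Q.
Proof.
move=> [P1 P2 P3 P4] [Q1 Q2 Q3 Q4].
have MPQ : M *m P = M *m Q.
  by rewrite -[LHS]P3 -{1}Q1 -[_ *m M *m P]mulmxA trmx_mul P3 Q3 mulmxA P1.
have PMQ : P *m M = Q *m M.
  by rewrite -[LHS]P4 -{1}Q1 mulmxA mulmxA -mulmxA trmx_mul P4 Q4
     -mulmxA (mulmxA M) P1.
by rewrite -P2 PMQ -mulmxA MPQ mulmxA Q2.
Qed.

Definition mpinv (R : realType) (m n : nat) (M : 'M[R]_(m, n)) :
    'M[R]_(n, m) :=
  xget 0 [set P | penrose M P].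

Lemma mpinvP (R : realType) (m n : nat) (M : 'M[R]_(m, n)) :
  penrose M (mpinv M).
Proof. by have [P MP] := penrose_exists M; exact: (xgetI 0 MP). Qed.

Definition borel_matrix (R : realType) (m p : nat) :=
  g_sigma_algebraType (@open 'M[R]_(m, p)).

(* Entrywise, so that every expectation taken with [mx_expectation] below is
   finite and [fine] loses nothing. *)
Definition mx_integrable (R : realType) (m p k l : nat)
    (D : probability (borel_matrix R m p) R)
    (X : 'M[R]_(m, p) -> 'M[R]_(k, l)) : Prop :=
  forall i j, D.-integrable setT (EFin \o (fun S => X S i j)).

Definition mx_expectation (R : realType) (m p k l : nat)
    (D : probability (borel_matrix R m p) R)
    (X : 'M[R]_(m, p) -> 'M[R]_(k, l)) : 'M[R]_(k, l) :=
  \matrix_(i, j) fine ('E_D[fun S => X S i j])%E.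

(* [invmx] returns its argument when that is singular, which does not occur
   below: for B, G positive definite and rho > 0 the inverted matrices are
   positive definite. *)
Definition Hmx (R : realType) (m n p : nat) (A : 'M[R]_(m, n)) (B : 'M[R]_n)
    (G : 'M[R]_p) (rho : R) (S : 'M[R]_(m, p)) : 'M[R]_p :=
  invmx (rho^-1 *: G + S^T *m A *m invmx B *m A^T *m S).

Definition Zmx (R : realType) (m n p : nat) (A : 'M[R]_(m, n)) (B : 'M[R]_n)
    (G : 'M[R]_p) (rho : R) (S : 'M[R]_(m, p)) : 'M[R]_n :=
  A^T *m S *m Hmx A B G rho S *m S^T *m A.

Definition Fmx (R : realType) (m n p : nat) (A : 'M[R]_(m, n)) (B : 'M[R]_n)
    (G : 'M[R]_p) (rho : R) (S : 'M[R]_(m, p)) : 'M[R]_n :=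
  invmx (rho^-1 *: B + A^T *m S *m invmx G *m S^T *m A).

Definition Wmx (R : realType) (m n p : nat) (A : 'M[R]_(m, n)) (B : 'M[R]_n)
    (G : 'M[R]_p) (rho : R) (S : 'M[R]_(m, p)) : 'M[R]_p :=
  S^T *m A *m Fmx A B G rho S *m A^T *m S.

Definition SHSmx (R : realType) (m n p : nat) (A : 'M[R]_(m, n)) (B : 'M[R]_n)
    (G : 'M[R]_p) (rho : R) (S : 'M[R]_(m, p)) : 'M[R]_m :=
  S *m Hmx A B G rho S *m S^T.

Definition xstar (R : realType) (m n : nat) (A : 'M[R]_(m, n)) (b : 'cV[R]_m)
    (B : 'M[R]_n) (x0 : 'cV[R]_n) : 'cV[R]_n :=
  x0 - invmx B *m A^T *m mpinv (A *m invmx B *m A^T) *m (A *m x0 - b).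

Definition linsys_solutions (R : realType) (m n : nat) (A : 'M[R]_(m, n))
    (b : 'cV[R]_m) (B : 'M[R]_n) (x0 : 'cV[R]_n) : set 'cV[R]_n :=
  minimizers [set x | A *m x = b] (fun x => sqnorm B (x - x0)).

Definition reformulation (R : realType) (m n p : nat) (A : 'M[R]_(m, n))
    (b : 'cV[R]_m) (B : 'M[R]_n) (x0 : 'cV[R]_n) (G : 'M[R]_p)
    (D : probability (borel_matrix R m p) R)
    (x : 'cV[R]_n) (z : 'cV[R]_p) (rho : R) : R :=
  2^-1 * sqnorm (mx_expectation D (Zmx A B G rho)) (x - xstar A b B x0)
  + (2 * rho)^-1 * sqnorm (mx_expectation D (Wmx A B G rho)) z.

(* Main.v *)
(* Since B and G are positive definite, the growth condition makes each
   reformulation a nonnegative quadratic that vanishes only at x^* (and z = 0).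
   With K = A B^-1 A^T, the kernel of K is that of A^T, hence K K^+ A = A and
   x^* is feasible; since B (x^* - x0) lies in the range of A^T, x^* - x0 is
   B-orthogonal to Null(A), and Pythagoras makes x^* the unique solution of
   the projection problem. *)

Require Import Defs.
From HB Require Import structures.
From mathcomp Require Import all_boot all_order all_algebra.
From mathcomp Require Import all_classical all_reals all_analysis.
From mathcomp Require Import ring.

Set Implicit Arguments.
Unset Strict Implicit.
Unset Printing Implicit Defensive.
Import Order.TTheory GRing.Theory Num.Theory.
Import numFieldNormedType.Exports.

Local Open Scope classical_set_scope.
Local Open Scope ring_scope.

(** A feasible [y] with [f y < f t] would have to equal [t], which is absurd. All three
    characterisations of minimizers in the theorem reduce to this sublevel-set criterion. *)
Lemma minimizers_unique (R : realType) (T : Type) (C : set T) (f : T -> R)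
    (t : T) : C t -> (forall y, C y -> f y <= f t -> y = t) ->
  forall x, minimizers C f x <-> x = t.
Proof.
move=> Ct tlt x; split=> [[Cx /(_ t Ct)]|->]; first exact: tlt.
split=> // y Cy; rewrite leNgt; apply/negP => fy_lt.
by move: (fy_lt); rewrite (tlt y Cy (ltW fy_lt)) ltxx.
Qed.

Lemma sqnorm0 (R : realType) (n : nat) (M : 'M[R]_n) : sqnorm M 0 = 0.
Proof. by rewrite /sqnorm mulmx0 mxE. Qed.

Lemma sqnormD (R : realType) (n : nat) (M : 'M[R]_n) (u v : 'cV[R]_n) :
  M^T = M ->
  sqnorm M (u + v) = sqnorm M u + sqnorm M v + 2 * (u^T *m M *m v) 0 0.
Proof.
(* The two cross terms coincide: a 1 by 1 matrix equals its transpose, and [M] is symmetric. *)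
move=> Msym; have vMu : (v^T *m M *m u) 0 0 = (u^T *m M *m v) 0 0.
  have -> : u^T *m M *m v = (v^T *m M *m u)^T.
    by rewrite !trmx_mul trmxK Msym mulmxA.
  by rewrite [RHS]mxE.
rewrite /sqnorm [(u + v)^T]raddfD /= !mulmxDl !mulmxDr.
rewrite [LHS]mxE [X in X + _]mxE [X in _ + X]mxE vMu; ring.
Qed.

Lemma posdef_sqnorm_ge0 (R : realType) (n : nat) (M : 'M[R]_n) (x : 'cV[R]_n) :
  posdef M -> 0 <= sqnorm M x.
Proof.
move=> [_ Mpos]; have [->|/Mpos/ltW//] := eqVneq x 0.
by rewrite sqnorm0.
Qed.

Lemma posdef_sqnorm_le0 (R : realType) (n : nat) (M : 'M[R]_n) (x : 'cV[R]_n) :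
  posdef M -> sqnorm M x <= 0 -> x = 0.
Proof.
by move=> [_ Mpos]; have [//|/Mpos] := eqVneq x 0; rewrite ltNge => /negP.
Qed.

Lemma posdef_unitmx (R : realType) (n : nat) (M : 'M[R]_n) :
  posdef M -> M \in unitmx.
Proof.
move=> Mpd; rewrite -row_free_unit; apply/inj_row_free => v vM0.
apply: trmx_inj; rewrite trmx0; apply: posdef_sqnorm_le0 Mpd _.
by rewrite /sqnorm trmxK vM0 mul0mx mxE.
Qed.

Lemma posdef_gram_eq0 (R : realType) (n k : nat) (B : 'M[R]_n)
    (C : 'M[R]_(n, k)) : posdef B -> C^T *m invmx B *m C = 0 -> C = 0.
Proof.
move=> Bpd CBC0; have uB := posdef_unitmx Bpd.
apply/matrixP => i j; rewrite mxE.
suff /colP/(_ i) : col j C = 0 by rewrite !mxE.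
suff Bc0 : invmx B *m col j C = 0 by rewrite -(mulKVmx uB (col j C)) Bc0 mulmx0.
(* For a column c of [C], the squared B-norm of B^-1 c is c^T B^-1 c, a diagonal entry of the
   vanishing Gram matrix. *)
apply: (posdef_sqnorm_le0 Bpd).
rewrite /sqnorm trmx_mul trmx_inv Bpd.1 mulmxKV // colE !trmx_mul.
by rewrite !mulmxA -2!(mulmxA (delta_mx j 0)^T) CBC0 mulmx0 mul0mx mxE.
Qed.

(** With P = K K^+, which is symmetric and satisfies P K = K, the B^-1-weighted Gram matrix of (1 -
    P) A is (1 - P) K (1 - P) = 0, so (1 - P) A = 0. *)
Lemma mpinv_gramK (R : realType) (m n : nat) (A : 'M[R]_(m, n)) (B : 'M[R]_n) :
  posdef B ->
  A *m invmx B *m A^T *m mpinv (A *m invmx B *m A^T) *m A = A.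
Proof.
move=> Bpd; set K := _ *m A^T; have [KPK _ KPsym _] := mpinvP K.
set P := K *m mpinv K in KPK KPsym *.
apply/eqP; rewrite -subr_eq0 -oppr_eq0 opprB; apply/eqP/trmx_inj.
rewrite trmx0; apply: (posdef_gram_eq0 Bpd); rewrite trmxK.
rewrite -{1}[A]mul1mx -mulmxBl linearB /= trmx_mul KPsym.
have -> : A^T - A^T *m P = A^T *m (1%:M - P) by rewrite mulmxBr mulmx1.
transitivity ((1%:M - P) *m K *m (1%:M - P)); first by rewrite !mulmxA.
by rewrite mulmxBl mul1mx KPK subrr mul0mx.
Qed.

Lemma xstar_feasible (R : realType) (m n : nat) (A : 'M[R]_(m, n))
    (b : 'cV[R]_m) (B : 'M[R]_n) (x0 : 'cV[R]_n) :
  posdef B -> (exists x : 'cV[R]_n, A *m x = b) -> A *m xstar A b B x0 = b.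
Proof.
(* Consistency turns the residual into A (x0 - x), to which K K^+ A = A applies. *)
move=> Bpd [x <-]; rewrite /xstar -mulmxBr [LHS]mulmxBr !mulmxA mpinv_gramK //.
by rewrite mulmxBr subKr.
Qed.

Lemma xstar_pythagoras (R : realType) (m n : nat) (A : 'M[R]_(m, n))
    (b : 'cV[R]_m) (B : 'M[R]_n) (x0 y : 'cV[R]_n) :
  posdef B -> A *m y = b ->
  sqnorm B (y - x0)
  = sqnorm B (y - xstar A b B x0) + sqnorm B (xstar A b B x0 - x0).
Proof.
move=> Bpd Ayb; set xs := xstar A b B x0.
have Axs : A *m xs = b by apply: xstar_feasible => //; exists y.
rewrite -[y - x0](subrKA xs) [LHS]sqnormD ?Bpd.1 //.
suff -> : (y - xs)^T *m B *m (xs - x0) = 0 by rewrite mxE mulr0 addr0.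
(* Here [B] cancels B^-1 in [xs - x0], leaving a factor [A^T] that is annihilated by
   [(y - xs)^T]. *)
rewrite {2}/xs /xstar addrAC subrr add0r mulmxN !mulmxA.
rewrite mulmxK ?posdef_unitmx //.
have -> : (y - xs)^T *m A^T = 0.
  by rewrite -trmx_mul mulmxBr Ayb Axs subrr trmx0.
by rewrite !mul0mx oppr0.
Qed.

Lemma linsys_solutionsP (R : realType) (m n : nat) (A : 'M[R]_(m, n))
    (b : 'cV[R]_m) (B : 'M[R]_n) (x0 : 'cV[R]_n) :
  posdef B -> (exists x : 'cV[R]_n, A *m x = b) ->
  forall x, linsys_solutions A b B x0 x <-> x = xstar A b B x0.
Proof.
move=> Bpd consistent; apply: minimizers_unique.
  exact: xstar_feasible.
(* The excess of the objective at [y] over its value at x^* is exactly the squared B-norm of their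
   difference. *)
move=> y Ayb; rewrite (xstar_pythagoras x0 Bpd Ayb) gerDr => yle.
by apply/eqP; rewrite -subr_eq0; apply/eqP/(posdef_sqnorm_le0 Bpd).
Qed.

Theorem lemma2p10 (R : realType) (m n p : nat) (A : 'M[R]_(m, n))
    (b : 'cV[R]_m) (x0 : 'cV[R]_n) (B : 'M[R]_n) (G : 'M[R]_p)
    (D : probability (borel_matrix R m p) R) (rho : R)
    (consistent : exists x : 'cV[R]_n, A *m x = b)
    (B_posdef : posdef B) (G_posdef : posdef G)
    (rho_gt0 : 0 < rho)
    (SHS_integrable : mx_integrable D (SHSmx A B G rho))
    (Z_integrable : mx_integrable D (Zmx A B G rho))
    (W_integrable : mx_integrable D (Wmx A B G rho))
    (null_sub : nullspace (mx_expectation D (SHSmx A B G rho))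
                `<=` nullspace A^T)
    (EW_posdef : posdef (mx_expectation D (Wmx A B G rho)))
    (growth : exists mu : R, 0 < mu /\
       forall (x : 'cV[R]_n) (z : 'cV[R]_p),
         mu * (sqnorm B (x - xstar A b B x0) + rho^-1 * sqnorm G z)
         <= sqnorm (mx_expectation D (Zmx A B G rho)) (x - xstar A b B x0)
            + rho^-1 * sqnorm (mx_expectation D (Wmx A B G rho)) z) :
  [/\ forall x : 'cV[R]_n,
        minimizers setT (fun y => reformulation A b B x0 G D y 0 rho) x
        <-> linsys_solutions A b B x0 x,
      forall x : 'cV[R]_n,
        linsys_solutions A b B x0 x <-> x = xstar A b B x0
    & forall (x : 'cV[R]_n) (z : 'cV[R]_p),
        minimizers setT
          (fun u : 'cV[R]_n * 'cV[R]_p =>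
             reformulation A b B x0 G D u.1 u.2 rho) (x, z)
        <-> x = xstar A b B x0 /\ z = 0].
Proof.
set xs := xstar A b B x0 in growth *.
have [mu [mu_gt0 grow]] := growth.
(* Factoring out 1/2 exposes the quantity bounded below by [growth]. *)
have fE x z : reformulation A b B x0 G D x z rho
    = 2^-1 * (sqnorm (mx_expectation D (Zmx A B G rho)) (x - xs)
       + rho^-1 * sqnorm (mx_expectation D (Wmx A B G rho)) z).
  by rewrite /reformulation invfM mulrDr mulrA.
have f0 : reformulation A b B x0 G D xs 0 rho = 0.
  by rewrite fE subrr !sqnorm0 mulr0 addr0 mulr0.
(* Where f is nonpositive, [grow] makes the sum of the B-term and the G-term nonpositive; both are
   nonnegative, so each vanishes. *)
have f_le0 x z : reformulation A b B x0 G D x z rho <= 0 -> x = xs /\ z = 0.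
  rewrite fE pmulr_rle0 ?invr_gt0 // => /(le_trans (grow x z)).
  rewrite pmulr_rle0 // => fle.
  have xB := posdef_sqnorm_ge0 (x - xs) B_posdef.
  have zG : 0 <= rho^-1 * sqnorm G z.
    by rewrite mulr_ge0 ?invr_ge0 ?(ltW rho_gt0) ?posdef_sqnorm_ge0.
  split.
    apply/eqP; rewrite -subr_eq0; apply/eqP/(posdef_sqnorm_le0 B_posdef).
    by apply: le_trans fle; rewrite lerDl.
  apply: (posdef_sqnorm_le0 G_posdef).
  rewrite -(pmulr_rle0 _ (_ : 0 < rho^-1)) ?invr_gt0 //.
  by apply: le_trans fle; rewrite lerDr.
split.
(* The penalty objective is the slice z = 0 of the augmented one, so the same bound serves both. *)
- move=> x; rewrite linsys_solutionsP //; apply: minimizers_unique => // y _.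
  by rewrite f0 => /f_le0[].
- exact: linsys_solutionsP.
- move=> x z.
  rewrite (@minimizers_unique _ _ _ _ (xs, 0)) //=; first by split=> [[]|[-> ->]].
  by move=> [y w] _ /=; rewrite f0 => /f_le0[-> ->].
Qed.
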